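(* Let $p$ be a prime, and let $a,l,n\in\mathbb N$ and $r\in\mathbb Z$. Then $$\sum_{k=0}^n\binom nk(-1)^kF_p\bigl(kp^a(p-1)+l,\,r\bigr)\equiv 0\pmod{p^{\,an+\lceil(n-l^* )/(p-1)\rceil}},$$ where $l^*=\{-l\}_{p-1}$.
   Context: $\mathbb N=\{0,1,2,\ldots\}$. For $a\in\mathbb Z$ and a positive integer $m$, $\{a\}_m$ denotes the least nonnegative residue of $a$ modulo $m$. $\lceil\cdot\rceil$ is the ceiling function. For a prime $p$, $n\in\mathbb N$ and $r\in\mathbb Z$, put $C_p(n,r)=\sum_{0\le k\le n,\ k\equiv r\,(\mathrm{mod}\ p)}\binom nk(-1)^k$. The Fleck quotient is $$F_p(n,r)=(-p)^{-\lfloor(n-1)/(p-1)\rfloor}C_p(n,r)+[\![n=0]\!],$$ where $[\![A]\!]$ is $1$ if the assertion $A$ holds and $0$ otherwise; it is an integer (Fleck). *)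

(* Defs.v *)
From mathcomp Require Import all_boot all_order all_algebra.

Set Implicit Arguments.
Unset Strict Implicit.
Unset Printing Implicit Defensive.

Import Order.TTheory GRing.Theory Num.Theory.
Local Open Scope ring_scope.

Definition fleck_sum (p n : nat) (r : int) : int :=
  \sum_(0 <= k < n.+1 | (k%:Z == r %[mod p%:Z])%Z) 'C(n, k)%:Z * (-1) ^+ k.

(* The Fleck quotient is kept in [rat], with its literal defining formula: it
   is integral by Fleck's theorem, but that is not presupposed here.  For
   n = 0 and p prime the exponent - floor (- 1 / (p - 1)) is 1. *)
Definition fleck_quotient (p n : nat) (r : int) : rat :=
  (- p%:R) ^ (- Num.floor ((n%:R - 1) / (p%:R - 1) : rat))
    * (fleck_sum p n r)%:~R + (n == 0%N)%:R.

(* Main.v *)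
Require Import Defs.
From mathcomp Require Import all_boot all_order all_algebra.
From mathcomp Require Import all_field.
From mathcomp Require Import ring lra zify.

Set Implicit Arguments.
Unset Strict Implicit.
Unset Printing Implicit Defensive.

Import Order.TTheory GRing.Theory Num.Theory.
Local Open Scope ring_scope.

(* Let z be a primitive p-th root of unity and pi = 1 - z^j with p not dividing j.
   Expanding (1 - pi)^p = 1 gives pi^(p-1) = -p u with u = 1 mod pi, and then
   u^(p^a) = 1 mod p^a pi.  The root-of-unity filter turns the Fleck quotient into
     F_p(m, r) = - (-p)^(- ceil(m / (p-1))) sum_(0 < j < p) z^(-jr) (1 - z^j)^m,
   so that, with c = ceil(l / (p-1)), the alternating binomial sum becomes
     - (-p)^(-c) sum_(0 < j < p) z^(-jr) (1 - z^j)^l (1 - u_j^(p^a))^n,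
   which is p^(an-c) times a rational multiple x of (1 - z)^(l+n) by an algebraic
   integer.  Then x^(p-1) is divisible by p^(l+n), hence x is divisible by
   p^(ceil((l+n)/(p-1))), and ceil((l+n)/(p-1)) - c = ceil((n - lstar)/(p-1)). *)

(** The binomial coefficients strictly between the ends are divisible by [p]; those from degree 2
    on, divided by [p], make up [y]. *)
Lemma prime_expr1D (p : nat) (x : algC) : prime p -> x \in Aint ->
  exists2 y, y \in Aint & (1 + x) ^+ p = 1 + p%:R * x * (1 + x * y) + x ^+ p.
Proof.
move=> p_pr Ax; case: p p_pr => [|[|q]] // p_pr.
exists (\sum_(i < q) x ^+ i * ('C(q.+2, i.+2) %/ q.+2)%:R).
  by apply: rpred_sum => i _; rewrite rpredM ?rpredX ?rpred_nat.
rewrite addrC exprD1n big_ord_recr binn mulr1n /=; congr (_ + _).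
rewrite 2!big_ord_recl bin0 /= bin1 mulr1n expr0 expr1; congr (_ + _).
rewrite mulrDr mulr1 mulr_natl; congr (_ + _).
rewrite !mulr_sumr; apply: eq_bigr => i _.
rewrite /bump !leq0n !add1n -mulr_natr.
have/dvdnP [m ->] : (q.+2 %| 'C(q.+2, i.+2))%N.
  by apply: prime_dvd_bin; rewrite //= !ltnS.
by rewrite mulnK // natrM !exprS; ring.
Qed.

(** Expand [(1 - pi)^p = 1] with [pi = 1 - z] and cancel one factor [pi]. *)
Lemma one_sub_unity_root_expr (p : nat) (z : algC) :
    prime p -> z ^+ p = 1 -> z != 1 ->
  exists2 w, w \in Aint & (1 - z) ^+ p.-1 = - p%:R * (1 + (1 - z) * w).
Proof.
move=> p_pr zp1 z1.
have Az : z \in Aint.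
  by apply: (@Aint_unity_root p); rewrite ?prime_gt0 //; apply/unity_rootP.
have pi0 : 1 - z != 0 by rewrite subr_eq0 eq_sym.
have p0 := prime_gt0 p_pr.
(* For odd [p] the expansion ends in [- pi^p]; for [p = 2] the sign differs, and [z = -1] is treated
   directly. *)
case: (even_prime p_pr) => [p2 | p_odd].
  move: zp1 => /eqP; rewrite {}p2 sqrf_eq1 (negPf z1) /= => /eqP ->.
  by exists (-1); rewrite ?rpredN ?rpred1 // expr1; ring.
have [|y Ay] := @prime_expr1D p (- (1 - z)) p_pr.
  by rewrite rpredN rpredB ?rpred1.
rewrite (_ : 1 + - (1 - z) = z); last by ring.
rewrite zp1 exprNn -signr_odd p_odd expr1 -(prednK p0) exprS => E.
exists (- y); first by rewrite rpredN.
apply: (mulfI pi0); rewrite prednK // in E *.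
set A := (1 - z) ^+ p.-1 in E *; set B := 1 - z in E *.
(* The left side of [E] is 1; writing [1 - 1] supplies an occurrence to rewrite. *)
have -> : B * A = 1 - 1 + B * A by ring.
by rewrite {1}E; ring.
Qed.

(** Induction on [a]: in the [p]-th power of [1 + p^a pi v] the linear term gains a factor [p], and
    so does the last term, by [pi^p = p pi y], which keeps one factor [pi]. *)
Lemma Aint_expr1D_primeX (p a : nat) (pi y w : algC) :
    prime p -> pi \in Aint -> y \in Aint -> w \in Aint ->
    pi ^+ p = p%:R * pi * y ->
  exists2 v, v \in Aint & (1 + pi * w) ^+ (p ^ a) = 1 + (p ^ a)%:R * pi * v.
Proof.
move=> p_pr Api Ay Aw pi_p; elim: a => [|a [v Av IH]].
  by exists w; rewrite // !expn0 expr1; ring.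
have Ax : (p ^ a)%:R * pi * v \in Aint by rewrite !rpredM ?rpred_nat.
have [x Axx E] := prime_expr1D p_pr Ax.
exists (v * (1 + (p ^ a)%:R * pi * v * x) + (p ^ (a * p.-1))%:R * y * v ^+ p).
  by rewrite !(rpredD, rpredM, rpredX, rpred1, rpred_nat).
rewrite expnSr exprM IH E !exprMn pi_p.
have -> : (p ^ a)%:R ^+ p = (p ^ a)%:R * (p ^ (a * p.-1))%:R :> algC.
  rewrite -natrX -natrM -expnM -expnD; congr (_ ^ _)%:R.
  by case: (p) p_pr => // q _; rewrite mulnS.
by rewrite natrM; ring.
Qed.

Lemma sum_prim_root_expr (F : fieldType) (n t : nat) (z : F) :
  n.-primitive_root z ->
  \sum_(j < n) (z ^+ j) ^+ t = if (n %| t)%N then n%:R else 0.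
Proof.
move=> zn; under eq_bigr do rewrite exprAC.
rewrite (prim_order_dvd zn); case: eqP => [->|/eqP zt].
  by under eq_bigr do rewrite expr1n; rewrite sumr_const card_ord.
apply: (@mulfI _ (z ^+ t - 1)); first by rewrite subr_eq0.
by rewrite -subrX1 mulr0 exprAC (prim_expr_order zn) expr1n subrr.
Qed.

(** Root-of-unity filter; the natural number [s] represents [- r] modulo [p], which avoids negative
    powers of [z]. *)
Lemma fleck_sum_prim_root (F : fieldType) (p n s : nat) (r : int) (z : F) :
    p.-primitive_root z -> (p%:Z %| r + s%:Z)%Z ->
  p%:R * (fleck_sum p n r)%:~R
    = \sum_(j < p) (z ^+ j) ^+ s * (1 - z ^+ j) ^+ n.
Proof.
move=> zp prs.
have E (j : nat) : (z ^+ j) ^+ s * (1 - z ^+ j) ^+ n =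
    \sum_(k < n.+1) (-1) ^+ k * 'C(n, k)%:R * (z ^+ j) ^+ (s + k).
  rewrite -[1 - _]addrC exprD1n mulr_sumr; apply: eq_bigr => k _.
  by rewrite exprNn -mulr_natr exprD; ring.
under [RHS]eq_bigr do rewrite E.
rewrite exchange_big /= /fleck_sum big_mkord rmorph_sum mulr_sumr big_mkcond /=.
apply: eq_bigr => k _.
rewrite -mulr_sumr (sum_prim_root_expr _ zp).
have -> : (p %| s + k)%N = ((k%:Z == r %[mod p%:Z])%Z).
  have -> : (p %| s + k)%N = (p%:Z %| k%:Z + s%:Z)%Z by rewrite addnC.
  rewrite eqz_mod_dvd; have -> : k%:Z + s%:Z = (k%:Z - r) + (r + s%:Z) by ring.
  by rewrite rpredDr.
case: ifP => _; last by rewrite mulr0.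
by rewrite rmorphM rmorphXn /= rmorphN1 -pmulrn; ring.
Qed.

Definition ceil_divn (n d : nat) : nat := ((n + d.-1) %/ d)%N.

Lemma ceil_divn_bounds (n d : nat) : (0 < d)%N ->
  (n <= ceil_divn n d * d < n + d)%N.
Proof.
move=> d0; rewrite /ceil_divn.
by have := divn_eq (n + d.-1) d; have := ltn_pmod (n + d.-1) d0; lia.
Qed.

Lemma ceil_divnMDl (k n d : nat) : (0 < d)%N ->
  ceil_divn (k * d + n) d = (k + ceil_divn n d)%N.
Proof. by move=> d0; rewrite /ceil_divn -addnA divnMDl. Qed.

(** For [m > 0], compare [p]-adic valuations: [N <= d * logn p m]. *)
Lemma dvdn_exp_ceil (p d N m : nat) : prime p -> (0 < d)%N ->
  (p ^ N %| m ^ d)%N -> (p ^ ceil_divn N d %| m)%N.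
Proof.
move=> p_pr d0; have [->|m0] := posnP m; first by rewrite dvdn0.
rewrite !pfactor_dvdn ?expn_gt0 ?m0 // lognX.
by have /andP[] := ceil_divn_bounds N d0; nia.
Qed.

(** A rational algebraic integer is an integer. This applies to [x], then to
    [x^(p-1) / p^N = w^N y^(p-1)], so [p^N] divides [x^(p-1)]. *)
Lemma rat_of_Aint_multiple (p N : nat) (pi w y : algC) (x : rat) :
    prime p -> pi \in Aint -> w \in Aint -> y \in Aint ->
    pi ^+ p.-1 = p%:R * w -> ratr x = pi ^+ N * y ->
  exists z : int, x = (p ^ ceil_divn N p.-1)%:R * z%:~R.
Proof.
move=> p_pr Api Aw Ay pi_p xE.
have d0 : (0 < p.-1)%N by have := prime_gt1 p_pr; lia.
have pN0 : (p ^ N)%:R != 0 :> algC.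
  by rewrite pnatr_eq0 -lt0n expn_gt0 prime_gt0.
have /intrP[m mE] : (ratr x : algC) \is a Num.int.
  by rewrite Cint_rat_Aint ?Crat_rat // xE rpredM ?rpredX.
have mdE : m%:~R ^+ p.-1 / (p ^ N)%:R = w ^+ N * y ^+ p.-1.
  by rewrite -mE xE exprMn exprAC pi_p exprMn -natrX mulrC !mulrA mulVf // mul1r.
have /intrP[k kE] : (m%:~R ^+ p.-1 / (p ^ N)%:R : algC) \is a Num.int.
  apply: Cint_rat_Aint; last by rewrite mdE rpredM ?rpredX.
  by rewrite rpred_div ?rpredX ?rpred_int ?rpred_nat.
have {}kE : m ^+ p.-1 = k * (p ^ N)%N%:Z.
  apply: (@intr_inj algC); rewrite rmorphXn rmorphM /= -kE -pmulrn.
  by rewrite divfK.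
have : (p ^ N %| `|m| ^ p.-1)%N.
  by rewrite -abszX kE abszM absz_nat dvdn_mull.
move/(dvdn_exp_ceil p_pr d0).
rewrite -[(p ^ _)%N]absz_nat -dvdzE => /dvdzP [z zE].
exists z; apply: (fmorph_inj (ratr : {rmorphism rat -> algC})).
by rewrite /= mE zE !rmorphM /= ratr_int ratr_nat -pmulrn mulrC.
Qed.

(* The [n = 0] correction in the Fleck quotient is exactly the term [j = 0] of the
   filter, so that this formula holds for all [n]. *)
Lemma fleck_quotient_prim_root (p n s : nat) (r : int) (z : algC) :
    prime p -> p.-primitive_root z -> (p%:Z %| r + s%:Z)%Z ->
  ratr (fleck_quotient p n r) =
    - (\sum_(1 <= j < p) (z ^+ j) ^+ s * (1 - z ^+ j) ^+ n)
      / (- p%:R) ^+ ceil_divn n p.-1.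
Proof.
move=> p_pr zp prs; have p1 := prime_gt1 p_pr; have p0 := prime_gt0 p_pr.
have d0 : (0 < p.-1)%N by lia.
have pC0 : - p%:R != 0 :> algC by rewrite oppr_eq0 pnatr_eq0 -lt0n.
set c := ceil_divn n p.-1.
(* The floor of [(n - 1) / (p - 1)] is one less than the ceiling of [n / (p - 1)], also for [n = 0],
   where it is -1. *)
have flE : Num.floor ((n%:R - 1) / (p%:R - 1) : rat) = c%:Z - 1.
  have -> : p%:R - 1 = p.-1%:R :> rat by rewrite -subn1 natrB.
  have dR : 0 < p.-1%:R :> rat by rewrite ltr0n.
  apply: floor_def; rewrite subrK rmorphB rmorph1 /= -pmulrn.
  rewrite ler_pdivlMr // ltr_pdivrMr //.
  have /andP[lo hi] := ceil_divn_bounds n d0; rewrite -/c in lo hi.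
  move: lo hi; rewrite -(ltr_nat rat) -(ler_nat rat) natrM natrD => lo hi.
  (* The numerator [n - 1] needs the strict bound in its integral form, sharper by one. *)
  have {hi} : (c * p.-1).+1%:R <= (n + p.-1)%:R :> rat.
    by rewrite ler_nat; have /andP[] := ceil_divn_bounds n d0.
  rewrite -natr1 natrM natrD => hi.
  apply/andP; split; last by lra.
  rewrite mulrBl mul1r; lra.
have := fleck_sum_prim_root n zp prs.
rewrite -(big_mkord xpredT (fun j => (z ^+ j) ^+ s * (1 - z ^+ j) ^+ n)).
rewrite big_ltn // expr0 expr1n mul1r subrr expr0n => sumE.
rewrite /fleck_quotient flE rmorphD rmorphM /= ratr_int ratr_nat.
have -> : - (c%:Z - 1) = 1 - c%:Z by ring.
have pQ0 : - p%:R != 0 :> rat by rewrite oppr_eq0 pnatr_eq0 -lt0n.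
rewrite expfzDr // expr1z -exprnN.
rewrite rmorphM /= fmorphV rmorphXn /= rmorphN /= ratr_nat.
set C := (- p%:R) ^+ c; have C0 : C != 0 by rewrite expf_neq0.
rewrite mulrAC mulNr.
(* If [n = 0] then [c = 0] and [C = 1], so the correction may share the denominator. *)
have -> : (n == 0%N)%:R = (n == 0%N)%:R / C.
  case: (n) @c @C C0 {flE} => [|m] c C C0; last by rewrite mul0r.
  by rewrite /C /c /ceil_divn add0n divn_small ?ltn_predL // expr0 divr1.
by rewrite sumE; ring.
Qed.

(** Since [pi^(p-1) = -p u], the binomial theorem gives [pi^l (1 - u^(p^a))^n]. Any nontrivial [z]
    is allowed, so that each [z^j] can be inserted. *)
Lemma sum_uniformizer_powers (p a l n : nat) (z : algC) :
    prime p -> z ^+ p = 1 -> z != 1 ->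
  exists2 Y, Y \in Aint &
    \sum_(0 <= k < n.+1) 'C(n, k)%:R * (-1) ^+ k
        * ((1 - z) ^+ (k * p ^ a * p.-1 + l) / (- p%:R) ^+ (k * p ^ a))
      = (p ^ (a * n))%:R * (1 - z) ^+ (l + n) * Y.
Proof.
move=> p_pr zp1 z1; have p0 := prime_gt0 p_pr.
have [w Aw wE] := one_sub_unity_root_expr p_pr zp1 z1.
have Az : z \in Aint.
  by apply: (@Aint_unity_root p); rewrite ?prime_gt0 //; apply/unity_rootP.
have Api : 1 - z \in Aint by rewrite rpredB ?rpred1.
set pi := 1 - z in wE Api *; set u := 1 + pi * w in wE *.
have pC0 : - p%:R != 0 :> algC by rewrite oppr_eq0 pnatr_eq0 -lt0n.
have pi_p : pi ^+ p = p%:R * pi * - u.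
  by rewrite -{1}(prednK p0) exprS wE; ring.
have [|v Av vE] := Aint_expr1D_primeX a p_pr Api _ Aw pi_p.
  by rewrite rpredN rpredD ?rpredM ?rpred1.
exists ((- v) ^+ n); first by rewrite rpredX ?rpredN.
have E k : pi ^+ (k * p ^ a * p.-1 + l) / (- p%:R) ^+ (k * p ^ a)
    = pi ^+ l * (u ^+ (p ^ a)) ^+ k.
  rewrite exprD (mulnC _ p.-1) exprM wE exprMn mulrC !mulrA mulVf ?expf_neq0 //.
  by rewrite mul1r mulrC (mulnC k) exprM.
under eq_bigr do rewrite E mulrCA.
rewrite /= -mulr_sumr big_mkord.
have -> : \sum_(k < n.+1) 'C(n, k)%:R * (-1) ^+ k * (u ^+ (p ^ a)) ^+ k
    = (1 - u ^+ (p ^ a)) ^+ n.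
  rewrite -[1 - _]addrC exprD1n; apply: eq_bigr => k _.
  by rewrite [in RHS]exprNn -mulr_natr; ring.
rewrite vE.
have -> : 1 - (1 + (p ^ a)%:R * pi * v) = (p ^ a)%:R * pi * - v by ring.
by rewrite !exprMn exprD -natrX expnM; ring.
Qed.

Theorem theorem1p3 (p a l n : nat) (r : int) (p_prime : prime p) :
  let lstar : int := ((- l%:Z) %% (p%:Z - 1))%Z in
  let e : int :=
    (a * n)%N%:Z + Num.ceil ((n%:R - lstar%:~R) / (p%:R - 1) : rat) in
  exists z : int,
    \sum_(0 <= k < n.+1)
      'C(n, k)%:R * (-1) ^+ k * fleck_quotient p (k * p ^ a * (p - 1) + l)%N r
    = p%:R ^ e * z%:~R.
Proof.
move=> lstar e.
have p0 := prime_gt0 p_prime.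
have d0 : (0 < p.-1)%N by have := prime_gt1 p_prime; lia.
have pQ0 : p%:R != 0 :> rat by rewrite pnatr_eq0 -lt0n.
have eE : e = (a * n)%:Z
    + ((ceil_divn (l + n) p.-1)%:Z - (ceil_divn l p.-1)%:Z).
  have /andP[lo hi] := ceil_divn_bounds l d0.
  (* [lstar] is the distance from [l] up to the next multiple of [p - 1]. *)
  have lstarE : lstar = (ceil_divn l p.-1)%:Z * p.-1%:Z - l%:Z.
    rewrite /lstar; have -> : p%:Z - 1 = p.-1%:Z by lia.
    by rewrite -(modzMDl (ceil_divn l p.-1)%:Z) modz_small //; lia.
  congr (_ + _); apply: ceil_def.
  have -> : p%:R - 1 = p.-1%:R :> rat by rewrite -subn1 natrB.
  have dR : 0 < p.-1%:R :> rat by rewrite ltr0n.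
  have /andP[] := ceil_divn_bounds (l + n) d0.
  rewrite -(ltr_nat rat) -(ler_nat rat) !natrM !natrD => lo' hi'.
  rewrite lstarE ltr_pdivlMr // ler_pdivrMr //.
  rewrite !rmorphB rmorphM rmorph1 /= -!pmulrn.
  by apply/andP; split; lra.
pose s := `|((- r) %% p%:Z)%Z|%N.
have prs : (p%:Z %| r + s%:Z)%Z.
  rewrite /s gez0_abs; last by rewrite modz_ge0 //; lia.
  by rewrite addrC -[X in _ + X]opprK -eqz_mod_dvd modz_mod.
have [z zp] := C_prim_root_exists p0.
have Az := Aint_prim_root zp.
have z1 : z != 1.
  by rewrite -(prim_order_dvd zp 1) dvdn1 neq_ltn prime_gt1 ?orbT.
have zp1 := prim_expr_order zp.
have [w Aw wE] := one_sub_unity_root_expr p_prime zp1 z1.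
set S := \sum_(0 <= k < n.+1) _.
set c := ceil_divn l p.-1 in eE.
(* Removing [p^(an - c)] leaves exactly the power of [p] that [rat_of_Aint_multiple] provides with
   [N = l + n]. *)
pose x : rat := S * p%:R ^+ c / p%:R ^+ (a * n).
suff [m xE] : exists m : int, x = (p ^ ceil_divn (l + n) p.-1)%:R * m%:~R.
  exists m.
  have -> : S = x * p%:R ^+ (a * n) / p%:R ^+ c.
    by rewrite /x divfK ?mulfK // expf_neq0.
  by rewrite xE eE !expfzDr // -exprnN -!exprnP natrX; ring.
have Az1 : 1 - z \in Aint by rewrite rpredB ?rpred1.
have Aw' : - (1 + (1 - z) * w) \in Aint.
  by rewrite rpredN rpredD ?rpredM ?rpred1.
have pC0 : p%:R != 0 :> algC by rewrite pnatr_eq0 -lt0n.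
pose y := (ratr x : algC) / (1 - z) ^+ (l + n).
have pi0 : 1 - z != 0 by rewrite subr_eq0 eq_sym.
have z1X : (1 - z) ^+ (l + n) != 0 by rewrite expf_neq0.
apply: (@rat_of_Aint_multiple _ _ (1 - z) _ y _ p_prime Az1 Aw').
- suff -> : y = - (-1) ^+ c * \sum_(1 <= j < p) (z ^+ j) ^+ s *
      ((\sum_(0 <= k < n.+1) 'C(n, k)%:R * (-1) ^+ k
        * ((1 - z ^+ j) ^+ (k * p ^ a * p.-1 + l) / (- p%:R) ^+ (k * p ^ a)))
      / (p%:R ^+ (a * n) * (1 - z) ^+ (l + n))).
    rewrite rpredM ?rpredN ?rpredX ?rpredN ?rpred1 //.
    rewrite big_seq rpred_sum // => j.
    rewrite mem_index_iota => /andP[j1 jp].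
    have zj1 : z ^+ j != 1.
      by rewrite -(prim_order_dvd zp) gtnNdvd.
    have zjp : (z ^+ j) ^+ p = 1 by rewrite exprAC zp1 expr1n.
    have [Y AY ->] := sum_uniformizer_powers a l n p_prime zjp zj1.
    apply: rpredM; first by rewrite !rpredX.
    (* This factorization lets all [j] share the same power of [1 - z]. *)
    have -> : 1 - z ^+ j = (1 - z) * \sum_(i < j) z ^+ i.
      by rewrite -opprB subrX1 -mulNr opprB.
    set q := \sum_(i < j) z ^+ i; rewrite exprMn natrX.
    rewrite (_ : _ * _ * Y = q ^+ (l + n) * Y
      * (p%:R ^+ (a * n) * (1 - z) ^+ (l + n))); last by ring.
    rewrite mulfK ?mulf_neq0 ?expf_neq0 //.
    by rewrite rpredM // rpredX // rpred_sum // => i _; rewrite rpredX.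
  rewrite /y /x !rmorphM fmorphV !rmorphXn /= ratr_nat rmorph_sum /=.
  rewrite !mulr_suml mulr_sumr.
  under [RHS]eq_bigr do rewrite mulr_suml mulr_sumr mulr_sumr.
  rewrite exchange_big /=; apply: eq_bigr => k _.
  rewrite subn1 !rmorphM /= rmorphXn /= rmorphN1 ratr_nat.
  rewrite (fleck_quotient_prim_root _ p_prime zp prs) ceil_divnMDl // -/c.
  rewrite -sumrN !mulr_suml mulr_sumr !mulr_suml; apply: eq_bigr => j _.
  rewrite !exprD !invfM.
  (* The sign is unfolded into the [p^c] from [x] and the [(-p)^c] from the Fleck quotient. *)
  have <- : p%:R ^+ c / (- p%:R) ^+ c = (-1) ^+ c :> algC.
    by rewrite -exprVn -exprMn invrN mulrN mulfV.
  by ring.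
- by rewrite wE; ring.
- by rewrite /y mulrC divfK.
Qed.
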